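(* Let $(\mathfrak{g},[\cdot,\cdot]_{\mathfrak{g}},B_{\mathfrak{g}})$ be a quadratic Lie algebra over $\mathbb{F}$, let $V$ be a finite-dimensional vector space and let $(\mathfrak{G},[\cdot,\cdot]_{\mathfrak{G}})$ be a central extension of $(\mathfrak{g},[\cdot,\cdot]_{\mathfrak{g}})$ by $V$. If there exists an invariant metric $B_{\mathfrak{G}}$ on $(\mathfrak{G},[\cdot,\cdot]_{\mathfrak{G}})$, then there are two non-degenerate ideals, $U$ and $U^{\perp}$, of $\mathfrak{G}$ such that: (i) $U\subseteq V$; (ii) $\mathfrak{G}=U^{\perp}\oplus U$; (iii) $(U^{\perp},[\cdot,\cdot]_{\mathfrak{G}}|_{U^{\perp}\times U^{\perp}},B_{\mathfrak{G}}|_{U^{\perp}\times U^{\perp}})$ is a central extension of $(\mathfrak{g},[\cdot,\cdot]_{\mathfrak{g}},B_{\mathfrak{g}})$ and the kernel of this extension is equal to $V\cap V^{\perp}$; i.e. there is a short exact sequence of Lie algebras $0\to V\cap V^{\perp}\to U^{\perp}\to\mathfrak{g}\to0$ with $V\cap V^{\perp}$ central in $U^{\perp}$.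
   Context: All Lie algebras are finite-dimensional over an algebraically closed field $\mathbb{F}$ of characteristic zero. An invariant metric on a Lie algebra $\mathfrak{g}$ is a non-degenerate symmetric bilinear form $B_{\mathfrak{g}}$ with $B_{\mathfrak{g}}(x,[y,z]_{\mathfrak{g}})=B_{\mathfrak{g}}([x,y]_{\mathfrak{g}},z)$ for all $x,y,z$; a quadratic Lie algebra is a Lie algebra with an invariant metric. A 2-cocycle of $\mathfrak{g}$ with values in $V$ is a skew-symmetric bilinear map $\theta:\mathfrak{g}\times\mathfrak{g}\to V$ with $\theta(x,[y,z]_{\mathfrak{g}})+\theta(y,[z,x]_{\mathfrak{g}})+\theta(z,[x,y]_{\mathfrak{g}})=0$. The central extension of $\mathfrak{g}$ by $V$ associated to $\theta$ is $\mathfrak{G}=\mathfrak{g}\oplus V$ with bracket $[x+u,y+v]_{\mathfrak{G}}=[x,y]_{\mathfrak{g}}+\theta(x,y)$; $V$ is its kernel. $\perp$ is taken in $\mathfrak{G}$ with respect to $B_{\mathfrak{G}}$; an ideal $I$ of $\mathfrak{G}$ is non-degenerate if $I\cap I^{\perp}=\{0\}$. *)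

(* Defs.v *)
From HB Require Import structures.
From mathcomp Require Import all_boot all_order all_algebra.
From mathcomp Require Import sesquilinear.

Set Implicit Arguments.
Unset Strict Implicit.
Unset Printing Implicit Defensive.

Import GRing.Theory.
Local Open Scope ring_scope.

Section LieAlgebra.
Variables (F : fieldType) (L : vectType F) (br : {bilinear L -> L -> L}).

Definition is_lie_bracket : Prop :=
  (forall x, br x x = 0) /\
  (forall x y z, br x (br y z) + br y (br z x) + br z (br x y) = 0).

Definition is_lie_ideal (I : {vspace L}) : Prop :=
  forall x y, y \in I -> br x y \in I.

Definition is_invariant_metric (B : {symmetric L}) : Prop :=
  nondegenerate B /\ (forall x y z, B x (br y z) = B (br x y) z).

Definition nondegenerate_on (B : {symmetric L}) (I : {vspace L}) : Prop :=
  (I :&: orthov B I)%VS = 0%VS.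

End LieAlgebra.

Section Restriction.
Variables (F : fieldType) (L : vectType F) (br : {bilinear L -> L -> L}).
Variables (B : {symmetric L}) (I : {vspace L}).

(* [vsproj I] is the identity on I, so this is the restriction of br to I x I
   as soon as I is closed under br; it has no meaning otherwise. *)
Definition restr_bracket (x y : subvs_of I) : subvs_of I :=
  vsproj I (br (vsval x) (vsval y)).

Fact restr_bracket_is_bilinear :
  bilinear_for (GRing.Scale.Law.clone _ _ *:%R _)
               (GRing.Scale.Law.clone _ _ *:%R _) restr_bracket.
Proof.
by split=> u a x y; rewrite /restr_bracket linearP ?linearPl ?linearPr linearP.
Qed.

HB.instance Definition _ :=
  bilinear_isBilinear.Build F (subvs_of I) (subvs_of I) (subvs_of I) _ _
    restr_bracket restr_bracket_is_bilinear.

Definition restr_form (x y : subvs_of I) : F := B (vsval x) (vsval y).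

Fact restr_form_is_bilinear :
  bilinear_for (GRing.Scale.Law.clone _ _ *%R _)
               (GRing.Scale.Law.clone _ _ (idfun \; *%R) _) restr_form.
Proof.
by split=> u a x y; rewrite /restr_form linearP ?linearPl ?linearPr.
Qed.

HB.instance Definition _ :=
  bilinear_isBilinear.Build F (subvs_of I) (subvs_of I) F _ _
    restr_form restr_form_is_bilinear.

Fact restr_form_sym (x y : subvs_of I) :
  restr_form x y = (-1) ^+ false * idfun (restr_form y x).
Proof. exact: hermC. Qed.

HB.instance Definition _ :=
  isHermitianSesquilinear.Build F (subvs_of I) false idfun
    restr_form restr_form_sym.

End Restriction.

Section CentralExtension.
Variables (F : fieldType) (g V : vectType F).
Variables (br : {bilinear g -> g -> g}) (theta : {bilinear g -> g -> V}).

Definition is_2cocycle : Prop :=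
  (forall x y, theta x y = - theta y x) /\
  (forall x y z,
     theta x (br y z) + theta y (br z x) + theta z (br x y) = 0).

Definition ext_bracket (s t : (g * V)%type) : (g * V)%type :=
  (br s.1 t.1, theta s.1 t.1).

Fact ext_bracket_is_bilinear :
  bilinear_for (GRing.Scale.Law.clone _ _ *:%R _)
               (GRing.Scale.Law.clone _ _ *:%R _) ext_bracket.
Proof.
split=> u a x y; rewrite /ext_bracket /=.
- by rewrite !linearPl.
- by rewrite !linearPr.
Qed.

HB.instance Definition _ :=
  bilinear_isBilinear.Build F (g * V)%type (g * V)%type (g * V)%type _ _
    ext_bracket ext_bracket_is_bilinear.

Lemma ext_bracket_lie :
  [pchar F] =i pred0 -> is_lie_bracket br -> is_2cocycle ->
  is_lie_bracket ext_bracket.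
Proof.
move=> charF [br_alt br_jac] [th_skew th_coc].
split=> [x | x y z]; last by congr (_, _); [exact: br_jac | exact: th_coc].
congr (_, _); first exact: br_alt.
have /eqP := th_skew x.1 x.1; rewrite -addr_eq0 -mulr2n -scaler_nat scaler_eq0.
by rewrite ((pcharf0P F).1 charF) /= => /eqP.
Qed.

End CentralExtension.

Section ExtensionKernel.
Variables (F : fieldType) (g V : vectType F).

Definition ext_inj (v : V) : (g * V)%type := (0, v).

Fact ext_inj_is_linear : linear ext_inj.
Proof. by move=> a u v; congr (_, _); rewrite /= scaler0 addr0. Qed.

HB.instance Definition _ :=
  GRing.isLinear.Build F V (g * V)%type *:%R ext_inj ext_inj_is_linear.

Definition ext_kernel : {vspace (g * V)} := limg (linfun ext_inj).

Lemma mem_ext_kernel (s : (g * V)%type) : (s \in ext_kernel) = (s.1 == 0).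
Proof.
apply/memv_imgP/eqP => [[v _ ->] | ]; first by rewrite lfunE.
by case: s => x v /= ->; exists v; rewrite ?memvf // lfunE.
Qed.

End ExtensionKernel.

Arguments ext_kernel {F} g V.

Definition is_lie_morphism (F : fieldType) (L M : vectType F)
    (brL : {bilinear L -> L -> L}) (brM : {bilinear M -> M -> M})
    (f : 'Hom(L, M)) : Prop :=
  forall x y, f (brL x y) = brM (f x) (f y).

Definition is_central_ses (F : fieldType) (K E g : vectType F)
    (brK : {bilinear K -> K -> K}) (brE : {bilinear E -> E -> E})
    (brg : {bilinear g -> g -> g}) (i : 'Hom(K, E)) (p : 'Hom(E, g)) : Prop :=
  [/\ is_lie_morphism brK brE i, is_lie_morphism brE brg p,
      [/\ lker i = 0%VS, limg i = lker p & limg p = fullv]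
    & forall k e, brE (i k) e = 0].

(* Main.v *)
(* Take for U any complement of the radical K = V :&: V^⊥ in V. Then U is
   non-degenerate, and it is an ideal because V is central. Since K is
   orthogonal to V, a vector of V orthogonal to U is orthogonal to all of V,
   so V :&: U^⊥ = K; this is the kernel of the projection of U^⊥ to g, which is
   onto because G = U^⊥ + U and U lies in V. *)

Require Import Defs.
From HB Require Import structures.
From mathcomp Require Import all_boot all_order all_algebra.
From mathcomp Require Import sesquilinear.

Set Implicit Arguments.
Unset Strict Implicit.
Unset Printing Implicit Defensive.

Import GRing.Theory.
Local Open Scope ring_scope.

Section Orthogonality.
Variables (F : fieldType) (L : vectType F) (B : {symmetric L}).
Implicit Types U : {vspace L}.

(** The map [f] pairs a vector with a basis of [U]; its kernel lies in [orthov B U] and its image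
    has dimension at most [\dim U], so rank-nullity gives the bound. *)
Lemma leq_dim_orthov U : (\dim {:L} <= \dim (orthov B U) + \dim U)%N.
Proof.
pose f x : 'rV[F]_(\dim U) := \row_i B x (vbasis U)`_i.
have f_lin : linear f.
  by move=> a x y; apply/rowP=> i; rewrite !mxE linearPl.
pose fL : {linear L -> 'rV[F]_(\dim U)} :=
  HB.pack f (GRing.isLinear.Build F L _ *:%R f f_lin).
rewrite -(limg_ker_dim (linfun fL) fullv) capfv leq_add //.
  apply/dimvS/subvP=> x; rewrite memv_ker lfunE => /eqP fx0.
  apply/mem_orthovP=> u /coord_vbasis->; rewrite linear_sumr big1 // => i _.
  by rewrite linearZr /=; have /rowP/(_ i) := fx0; rewrite !mxE => ->; rewrite mulr0.
by rewrite (leq_trans (dimvS (subvf _))) // dimvf /dim /= mul1n.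
Qed.

Lemma directv_orthov U : nondegenerate_on B U -> directv (orthov B U + U).
Proof. by move=> nU; apply/directv_addP; rewrite capvC. Qed.

(** The sum is direct, so by [leq_dim_orthov] its dimension is at least that of [L]. *)
Lemma addv_orthov U : nondegenerate_on B U -> (orthov B U + U)%VS = fullv.
Proof.
move=> nU; apply/eqP; rewrite eqEdim subvf dimv_disjoint_sum ?leq_dim_orthov //.
by rewrite capvC.
Qed.

(** A vector orthogonal to both [U] and [orthov B U] is orthogonal to their sum, which is all of
    [L], so it vanishes. *)
Lemma nondegenerate_on_orthov U :
  nondegenerate B -> nondegenerate_on B U -> nondegenerate_on B (orthov B U).
Proof.
move=> /eqP nB nU; apply/eqP; rewrite -subv0 -nB -(addv_orthov nU).
by rewrite orthovD capvSr capvSl.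
Qed.

(** Each vector of [U] splits as [v + w] with [v] in the complement and [w] in the radical of [B] on
    [U]. Any [x] in [U] is orthogonal to [w], so only the pairing with [v] has to be tested. *)
Lemma capv_orthov_diffv U :
  (U :&: orthov B (U :\: orthov B U) = U :&: orthov B U)%VS.
Proof.
apply/vspaceP=> x; rewrite !memv_cap; case: (boolP (x \in U)) => //= xU.
apply/mem_orthovP/mem_orthovP=> xP u uU; last first.
  exact: xP (subvP (diffvSl _ _) _ uU).
have /memv_addP[v vD [w]] : u \in (U :\: orthov B U + U :&: orthov B U)%VS.
  by rewrite addv_diff_cap.
rewrite memv_cap => /andP[_ /mem_orthovP wU] ->.
by rewrite linearDr /= xP // add0r; apply/eqP; rewrite herm_eq0C wU.
Qed.

(** By [capv_orthov_diffv], a vector of the complement that is orthogonal to the complement lies in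
    [orthov B U], which meets the complement in 0. *)
Lemma nondegenerate_on_diffv U : nondegenerate_on B (U :\: orthov B U).
Proof.
apply/eqP; rewrite -subv0 -(capv_diff U (orthov B U)) subv_cap capvSl.
apply: subv_trans (capvSr U _); rewrite -(capv_orthov_diffv U).
by rewrite capvS ?diffvSl.
Qed.

Lemma nondegenerate_restr_form U :
  nondegenerate_on B U -> nondegenerate (restr_form B (I := U)).
Proof.
move=> nU; rewrite /nondegenerate -subv0; apply/subvP=> x /mem_orthovP xP.
rewrite memv0; apply/eqP/val_inj/eqP; rewrite /= -memv0 -nU memv_cap subvsP /=.
by apply/mem_orthovP=> u uU; have := xP (vsproj U u) (memvf _);
  rewrite /= /restr_form vsprojK.
Qed.

End Orthogonality.

Section LieIdeals.
Variables (F : fieldType) (L : vectType F) (br : {bilinear L -> L -> L}).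
Hypothesis lie_br : is_lie_bracket br.

(** Polarization: expand the bracket of [x + y] with itself. *)
Lemma lie_bracketC x y : br x y = - br y x.
Proof.
have [alt _] := lie_br; apply/eqP; rewrite -addr_eq0.
by have := alt (x + y); rewrite linearDl !linearDr !alt add0r addr0 => /eqP.
Qed.

(** For [u] in [I], invariance gives $B([x,y],u) = -B(y,[x,u])$, and $[x,u]$ is again in [I]. *)
Lemma lie_ideal_orthov (B : {symmetric L}) (I : {vspace L}) :
  is_invariant_metric br B -> is_lie_ideal br I ->
  is_lie_ideal br (orthov B I).
Proof.
move=> [_ invB] idI x y /mem_orthovP yI; apply/mem_orthovP=> u uI.
by rewrite lie_bracketC linearNl /= -invB yI ?oppr0 // idI.
Qed.

Variable I : {vspace L}.
Hypothesis idI : is_lie_ideal br I.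

(** The bracket already lies in the ideal, so the projection fixes it; identities on [I] can thus be
    checked in [L]. *)
Lemma val_restr_bracket (x y : subvs_of I) :
  vsval (restr_bracket br x y) = br (vsval x) (vsval y).
Proof. by rewrite vsprojK // idI // subvsP. Qed.

Lemma restr_bracket_lie : is_lie_bracket (restr_bracket br (I := I)).
Proof.
have [alt jac] := lie_br; split=> [x | x y z]; apply/val_inj.
  by rewrite /= val_restr_bracket alt.
by rewrite /= !val_restr_bracket jac.
Qed.

Lemma restr_invariant_metric (B : {symmetric L}) :
  is_invariant_metric br B -> nondegenerate_on B I ->
  is_invariant_metric (restr_bracket br (I := I)) (restr_form B (I := I)).
Proof.
move=> [_ invB] nI; split; first exact: nondegenerate_restr_form.
by move=> x y z; rewrite /= /restr_form !val_restr_bracket.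
Qed.

End LieIdeals.

Section KernelOfCentralExtension.
Variables (F : fieldType) (g V : vectType F).
Variables (brg : {bilinear g -> g -> g}) (theta : {bilinear g -> g -> V}).
Implicit Type I : {vspace (g * V)}.

Lemma ext_kernel_central (x y : (g * V)%type) :
  y \in ext_kernel g V -> ext_bracket brg theta x y = 0.
Proof.
by rewrite mem_ext_kernel => /eqP y0; rewrite /ext_bracket y0 !linear0r.
Qed.

(** All brackets with vectors of the kernel vanish. This serves for both [U] and [K]. *)
Lemma lie_ideal_ext_kernel I :
  (I <= ext_kernel g V)%VS -> is_lie_ideal (ext_bracket brg theta) I.
Proof. by move=> /subvP IV x y /IV yV; rewrite /= ext_kernel_central ?mem0v. Qed.

End KernelOfCentralExtension.

Theorem proposition2p8 (F : closedFieldType) (charF : [pchar F] =i pred0)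
    (g : vectType F) (brg : {bilinear g -> g -> g}) (Bg : {symmetric g})
    (lie_g : is_lie_bracket brg) (metric_g : is_invariant_metric brg Bg)
    (V : vectType F) (theta : {bilinear g -> g -> V})
    (cocycle_theta : is_2cocycle brg theta)
    (BG : {symmetric (g * V)%type})
    (metric_G : is_invariant_metric (ext_bracket brg theta) BG) :
  exists U : {vspace (g * V)},
    let brG := ext_bracket brg theta in
    let Uperp := orthov BG U in
    let K := (ext_kernel g V :&: orthov BG (ext_kernel g V))%VS in
    [/\ [/\ is_lie_ideal brG U, nondegenerate_on BG U,
            is_lie_ideal brG Uperp & nondegenerate_on BG Uperp],
        (U <= ext_kernel g V)%VS,
        (Uperp + U)%VS = fullv /\ directv (Uperp + U)
      & [/\ is_lie_bracket (restr_bracket brG (I := Uperp)),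
            is_invariant_metric (restr_bracket brG (I := Uperp))
                                (restr_form BG (I := Uperp))
          & exists (i : 'Hom(subvs_of K, subvs_of Uperp))
                   (p : 'Hom(subvs_of Uperp, g)),
              (forall k, vsval (i k) = vsval k) /\
              is_central_ses (restr_bracket brG (I := K))
                (restr_bracket brG (I := Uperp)) brg i p]].
Proof.
have lie_G := ext_bracket_lie charF lie_g cocycle_theta.
set V' := ext_kernel g V.
exists (V' :\: orthov BG V')%VS => brG Uperp K.
set U := (V' :\: _)%VS in Uperp *.
have UV : (U <= V')%VS by exact: diffvSl.
have nU : nondegenerate_on BG U by exact: nondegenerate_on_diffv.
have idU : is_lie_ideal brG U by exact: lie_ideal_ext_kernel.
have idUp : is_lie_ideal brG Uperp by exact: lie_ideal_orthov.
have nUp : nondegenerate_on BG Uperp.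
  by apply: nondegenerate_on_orthov => //; case: metric_G.
have UpU : (Uperp + U)%VS = fullv by exact: addv_orthov.
(* The left side is what the kernel of [p] turns out to be. *)
have defK : (V' :&: Uperp)%VS = K by exact: capv_orthov_diffv.
have KUp : (K <= Uperp)%VS by rewrite -defK capvSr.
have idK : is_lie_ideal brG K.
  by apply: lie_ideal_ext_kernel; exact: capvSl.
split=> //; first by split=> //; exact: directv_orthov.
split; [exact: restr_bracket_lie | exact: restr_invariant_metric |].
(* [i] is the inclusion of [K] in [Uperp], and [p] is the projection of [g * V] to [g] restricted to
   [Uperp]. *)
pose i : 'Hom(subvs_of K, subvs_of Uperp) :=
  linfun (vsproj Uperp \o (vsval : subvs_of K -> _)).
pose p : 'Hom(subvs_of Uperp, g) :=
  linfun (fst \o (vsval : subvs_of Uperp -> _)).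
have iE k : vsval (i k) = vsval k.
  by rewrite lfunE /= vsprojK // (subvP KUp) ?subvsP.
have pE x : p x = (vsval x).1 by rewrite lfunE.
exists i, p; split=> //; split.
- move=> x y; apply/val_inj; rewrite /= iE !val_restr_bracket // !iE //.
- by move=> x y; rewrite !pE /= val_restr_bracket.
- split.
  + by apply/eqP/lker0P=> x y eq_ixy; apply/val_inj; rewrite /= -!iE eq_ixy.
  + apply/vspaceP=> x; rewrite memv_ker pE -mem_ext_kernel.
    apply/memv_imgP/idP => [[k _ ->] | xV].
      by rewrite iE; have := subvsP k; rewrite memv_cap => /andP[].
    have xK : vsval x \in K by rewrite -defK memv_cap xV subvsP.
    by exists (vsproj K (vsval x)); rewrite ?memvf //; apply/val_inj;
      rewrite /= iE vsprojK.
  (* To lift [a], take the [Uperp] component of [(a, 0)]: the component in [U] lies in the kernel,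
     so removing it keeps the first coordinate. *)
  + apply/vspaceP=> a; rewrite memvf; apply/memv_imgP.
    have /memv_addP[x xUp [u uU eq_a]] : (a, 0 : V) \in (Uperp + U)%VS.
      by rewrite UpU memvf.
    exists (vsproj Uperp x); rewrite ?memvf // pE vsprojK //.
    have := subvP UV u uU; rewrite mem_ext_kernel => /eqP u0.
    by have /(congr1 fst) := eq_a; rewrite /= u0 addr0.
(* Skew-symmetry moves the kernel element to the right, where [ext_kernel_central] applies. *)
- move=> k e; apply/val_inj; rewrite /= val_restr_bracket // lie_bracketC //.
  rewrite iE /= /brG ext_kernel_central ?oppr0 //.
  by have := subvsP k; rewrite memv_cap => /andP[].
Qed.
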